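(* Let $\mathcal{V}=\{1,2,3,4\}$ and let $\mathcal{W}$ be the edge weights given by $\mathcal{W}(i,j)=0.5$ if $i\neq j$ and $1\in\{i,j\}$; $\mathcal{W}(2,3)=\mathcal{W}(3,4)=\mathcal{W}(4,2)=1$; $\mathcal{W}(3,2)=\mathcal{W}(4,3)=\mathcal{W}(2,4)=0$. Let $f:\mathbb{R}\to\mathbb{R}$ be bounded with $f>0$ and $\dot f<0$ on $(0,\pi)$. Consider on $(\mathcal{S}^2)^4$ the closed-loop system $$\dot{\Gamma}_i=\widehat{\Gamma}_i \sum_{j\in \mathcal{V}\setminus\{i\}} \mathcal{W}(i,j)\,f(\theta_{ij})\,\widehat{\Gamma}_i\Gamma_j, \qquad i\in \mathcal{V},$$ restricted to its invariant manifold $$\Omega_T=\left\{ \mathbf{\Gamma} \in (\mathcal{S}^2)^4 : \Gamma^T_i\Gamma_j = -\tfrac{1}{3}\ \ \forall\, i \neq j \right\}.$$ Then, for the motion on $\Omega_T$, the reduced attitude $\Gamma_1$ remains stationary, and the whole formation spins about an axis passing through $\Gamma_1$ with constant angular velocity $\omega=\frac{\sqrt{3}}{2}f(\theta^* )$, where $\theta^*=\arccos(-\frac13)$.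
   Context: $\mathcal{S}^2=\{x\in\mathbb{R}^3:\|x\|=1\}$. A point $\mathbf{\Gamma}=(\Gamma_1,\Gamma_2,\Gamma_3,\Gamma_4)\in(\mathcal{S}^2)^4$ collects the reduced attitudes of four agents; elements of $\Omega_T$ are the regular tetrahedron formations. For $x=[x_1,x_2,x_3]^T\in\mathbb{R}^3$, $$\widehat{x}=\begin{pmatrix}0&-x_3&x_2\\ x_3&0&-x_1\\ -x_2&x_1&0\end{pmatrix},$$ so $\widehat{x}y=x\times y$. $\theta_{ij}=\arccos(\Gamma_i^T\Gamma_j)\in[0,\pi]$. $\dot f$ denotes the derivative of $f$. The value $\omega$ is the magnitude of the angular velocity. *)

(* Defs.v *)
From HB Require Import structures.
From mathcomp Require Import all_boot all_order all_algebra.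
From mathcomp Require Import all_classical all_reals all_analysis.
Set Implicit Arguments.
Unset Strict Implicit.
Unset Printing Implicit Defensive.
Import Order.TTheory GRing.Theory Num.Theory.
Import numFieldNormedType.Exports.
Local Open Scope classical_set_scope.
Local Open Scope ring_scope.

Definition dotp {R : realType} (x y : 'cV[R]_3) : R := (x^T *m y) 0 0.

(* The library norm `|x| on matrices is the max norm. *)
Definition euclidean_norm {R : realType} (x : 'cV[R]_3) : R :=
  Num.sqrt (dotp x x).

Definition sphere2 {R : realType} : set 'cV[R]_3 :=
  [set x | euclidean_norm x = 1].

Definition hat {R : realType} (x : 'cV[R]_3) : 'M[R]_3 :=
  let x1 := x 0 0 in let x2 := x 1 0 in let x3 := x 2%R 0 in
  \matrix_(i, j) (nth [::] [:: [::   0; - x3;   x2];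
                               [::  x3;    0; - x1];
                               [:: - x2;  x1;    0]] i)`_j.

(* The agents 1, 2, 3, 4 are the elements 0, 1, 2, 3 of 'I_4. *)
Definition agent (k : nat) : 'I_4 := inord k.-1.

Definition configuration (R : realType) := 'I_4 -> 'cV[R]_3.

(* The diagonal value 0 is a junk value: it is never used. *)
Definition edge_weight {R : realType} (i j : 'I_4) : R :=
  if i == j then 0
  else if (i == agent 1) || (j == agent 1) then 2^-1
  else if (i, j) \in [:: (agent 2, agent 3); (agent 3, agent 4);
                         (agent 4, agent 2)] then 1
  else 0.

Definition angle {R : realType} (G : configuration R) (i j : 'I_4) : R :=
  acos (dotp (G i) (G j)).

Definition closed_loop_field {R : realType} (W : 'I_4 -> 'I_4 -> R)
    (f : R -> R) (G : configuration R) (i : 'I_4) : 'cV[R]_3 :=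
  hat (G i) *m
    \sum_(j | j != i) (W i j * f (angle G i j)) *: (hat (G i) *m G j).

(* Forward trajectories on [0, +oo[, with values in (S^2)^4: differentiable at
   positive times and continuous up to the initial time. *)
Definition closed_loop_solution {R : realType} (W : 'I_4 -> 'I_4 -> R)
    (f : R -> R) (G : R -> configuration R) : Prop :=
  [/\ forall (t : R) i, 0 <= t -> sphere2 (G t i),
      forall i, {within `[0, +oo[, continuous (fun t : R => G t i)}
    & forall (t : R) i, 0 < t ->
        is_derive t 1 (fun s : R => G s i) (closed_loop_field W f (G t) i)].

Definition tetrahedra {R : realType} : set (configuration R) :=
  [set G | (forall i, sphere2 (G i)) /\
           (forall i j, i != j -> dotp (G i) (G j) = - (1 / 3))].

(* The configuration moves as a rigid body rotating about the origin with
   constant angular velocity vector Om: hat Om *m x is the cross product of Om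
   and x. *)
Definition spins_with_angular_velocity {R : realType} (G : R -> configuration R)
    (Om : 'cV[R]_3) : Prop :=
  forall (t : R) i, 0 < t -> is_derive t 1 (fun s : R => G s i) (hat Om *m G t i).

(* Main.v *)
Require Import Defs.
From HB Require Import structures.
From mathcomp Require Import all_boot all_order all_algebra.
From mathcomp Require Import all_classical all_reals all_analysis.
From mathcomp Require Import ring lra.
Set Implicit Arguments.
Unset Strict Implicit.
Unset Printing Implicit Defensive.
Import Order.TTheory GRing.Theory Num.Theory.
Import numFieldNormedType.Exports.
Local Open Scope classical_set_scope.
Local Open Scope ring_scope.

(** The inner products [c_ij] of the four attitudes obey a closed system:
    since [x * (x * y) = (x . y) x - |x|^2 y] for the cross product, the
    derivative of [c_ik] is the sum over [j] of
    [W i j f(acos c_ij) (c_ij c_ik - c_jk)], plus the same with [i] and [k]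
    exchanged.  At the tetrahedral values this vanishes
    ([edge_weight_balance]), which makes the tetrahedra formally invariant.

    Turning this into a statement on solutions needs a uniqueness argument,
    and [f] need not be locally Lipschitz: its derivative exists but may be
    discontinuous.  It suffices to compare with the single value taken at the
    tetrahedral angle: a bounded function that is differentiable at a point
    satisfies [|f x - f a| <= L |x - a|] for all [x] and that fixed [a]
    ([bounded_derivable_lipschitz_at]).  Hence the sum [V] of the squares of
    the deviations of the [c_ij] from their tetrahedral values satisfies
    [V' <= K V] all along a solution ([gram_defect_rate_le]), and Gronwall's
    inequality keeps it at zero ([tetrahedra_invariant]).

    On a tetrahedron the four vertices sum to zero, so the velocity of the first
    one vanishes and the others move along opposite edges, for instance
    [G_2' = f(theta) / 2 (G_4 - G_3)] ([tetrahedral_field]).  Those edges are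
    also the cross products with the apex: [x * y = 3/4 D (z - w)], where [D] is
    the triple product of [x, y, z] ([tetrahedron_cross]), so the velocity field
    is a rotation about [G_1] with coefficient [- 9/8 f(theta) D].  Finally
    [D^2 = 16/27] and [D] is continuous in time, so the orientation, and with it
    the angular velocity, never changes. *)

(** * Rates of change on the half-line of nonnegative times *)

(** Continuity is asked at time 0 but differentiability only afterwards, which is
    all that a forward trajectory provides; the rate at 0 is arbitrary. *)
Definition has_rate {R : realType} (h dh : R -> R) : Prop :=
  {within `[0, +oo[, continuous h} /\
  forall t : R, 0 < t -> is_derive t 1 h (dh t).

Lemma has_rate_eq {R : realType} (h dh k dk : R -> R) :
  has_rate h dh -> h =1 k -> dh =1 dk -> has_rate k dk.
Proof. by move=> rh /funext <- /funext <-. Qed.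

Lemma has_rate_cst {R : realType} (a : R) : has_rate (fun=> a) (fun=> 0).
Proof. by split=> [t|t _]; [exact: cvg_cst | exact: is_derive_cst]. Qed.

Lemma has_rateD {R : realType} (h dh k dk : R -> R) :
  has_rate h dh -> has_rate k dk ->
  has_rate (fun t => h t + k t) (fun t => dh t + dk t).
Proof.
move=> [ch rh] [ck rk]; split=> [t|t t0].
  by apply: continuousD; [exact: ch | exact: ck].
by have := rh t t0; have := rk t t0 => ? ?; exact: is_deriveD.
Qed.

Lemma has_rateM {R : realType} (h dh k dk : R -> R) :
  has_rate h dh -> has_rate k dk ->
  has_rate (fun t => h t * k t) (fun t => h t * dk t + k t * dh t).
Proof.
move=> [ch rh] [ck rk]; split=> [t|t t0].
  by apply: continuousM; [exact: ch | exact: ck].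
have := rh t t0; have := rk t t0 => ? ?; exact: is_deriveM.
Qed.

Lemma has_rate_sum {R : realType} (I : finType) (h dh : I -> R -> R) :
  (forall i, has_rate (h i) (dh i)) ->
  has_rate (fun t => \sum_i h i t) (fun t => \sum_i dh i t).
Proof.
move=> H; rewrite /index_enum; elim: (Finite.enum I) => [|i s IH].
  under eq_fun do rewrite big_nil; under [X in has_rate _ X]eq_fun do rewrite big_nil.
  exact: has_rate_cst.
under eq_fun do rewrite big_cons; under [X in has_rate _ X]eq_fun do rewrite big_cons.
exact: has_rateD.
Qed.

Lemma has_rate_mean_value {R : realType} (h dh : R -> R) (t : R) :
  has_rate h dh -> 0 < t -> exists2 c, 0 < c & h t - h 0 = dh c * t.
Proof.
move=> [ch rh] t0.
have [||c] := @MVT R h dh 0 t t0.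
- by move=> x /itvP xt; apply: rh; rewrite xt.
- by apply: continuous_subspaceW ch; apply: subset_itvl; rewrite bnd_simp.
by move=> /itvP ct ->; exists c; rewrite ?ct // subr0.
Qed.

Lemma has_rate0_cst {R : realType} (h dh : R -> R) :
  has_rate h dh -> (forall t : R, 0 < t -> dh t = 0) ->
  forall t : R, 0 <= t -> h t = h 0.
Proof.
move=> rh dh0 t; rewrite le_eqVlt => /predU1P[<- //|t0].
have [c c0] := has_rate_mean_value rh t0.
by rewrite dh0 // mul0r => /eqP; rewrite subr_eq0 => /eqP.
Qed.

(** Gronwall's inequality: [h t * expR (- K t)] has a nonpositive rate. *)
Lemma gronwall_nonpos {R : realType} (h dh : R -> R) (K : R) :
  has_rate h dh -> (forall t : R, 0 < t -> dh t <= K * h t) -> h 0 <= 0 ->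
  forall t : R, 0 <= t -> h t <= 0.
Proof.
move=> rh dhK h0 t; rewrite le_eqVlt => /predU1P[<- //|t0].
have re : has_rate (fun t => expR (- K * t)) (fun t => - K * expR (- K * t)).
  split=> [|s _].
    apply: continuous_subspaceT => x; apply: continuous_comp.
      by apply: continuousM; [exact: cvg_cst|exact: cvg_id].
    exact: continuous_expR.
  have dl : is_derive s 1 (fun t : R => - K * t) (- K).
    have := is_deriveZ (- K) (is_derive_id s (1 : R)).
    by rewrite /GRing.scale /= mulr1.
  have := is_derive1_comp (is_derive_expR (- K * s)) dl.
  by rewrite mulrC.
have [c c0] := has_rate_mean_value (has_rateM rh re) t0.
rewrite mulr0 expR0 mulr1 => E.
have : expR (- K * c) * (dh c - K * h c) * t <= 0.
  rewrite pmulr_lle0 // pmulr_rle0 ?expR_gt0 // subr_le0; exact: dhK.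
have -> : expR (- K * c) * (dh c - K * h c) * t =
  (h c * (- K * expR (- K * c)) + expR (- K * c) * dh c) * t by ring.
rewrite -E => L; rewrite -(pmulr_lle0 _ (expR_gt0 (- K * t))); lra.
Qed.

Lemma has_rate_entry {R : realType} (m n : nat) (X dX : R -> 'M[R]_(m, n)) i j :
  {within `[0, +oo[, continuous X} ->
  (forall t : R, 0 < t -> is_derive t 1 X (dX t)) ->
  has_rate (fun t => X t i j) (fun t => dX t i j).
Proof.
move=> cX rX; split=> [t|t t0].
  exact: cvg_comp (cX t) (@coord_continuous _ _ _ i j (X t)).
have [dX' eX] := rX t t0.
have ij := (derivable_mxP X t 1).1 dX' i j.
by apply: DeriveDef => //; rewrite -eX derive_mx // mxE.
Qed.

(** Near [a] the difference quotients stay within 1 of the derivative [l]; at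
    distance at least [d] from [a] the bound [2 B] on the increments of [g]
    is at most [2 B / d] times the distance. *)
Lemma bounded_derivable_lipschitz_at {R : realType} (g : R -> R) (a : R) :
  bounded_fun g -> derivable g a 1 ->
  exists2 L, 0 <= L & forall x, `|g x - g a| <= L * `|x - a|.
Proof.
move=> [B [_ gB]] /cvg_ex[/= l /cvgrPdist_le /(_ 1 ltr01) [/= d d0 dl]].
pose B1 := `|B| + 1.
have {gB}gB x : `|g x| <= B1.
  by apply: (gB B1) => //; rewrite /B1 (le_lt_trans (ler_norm B)) // ltrDl.
have B0 : 0 <= B1 by rewrite addr_ge0.
exists (`|l| + 1 + 2 * B1 / d).
  by rewrite !addr_ge0 // divr_ge0 ?mulr_ge0 // ltW.
move=> x; have [->|xa] := eqVneq x a; first by rewrite !subrr normr0 mulr0.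
have xa0 : 0 < `|x - a| by rewrite normr_gt0 subr_eq0.
have [far|near] := leP d `|x - a|.
  apply: (@le_trans _ _ (2 * B1)).
    by rewrite (le_trans (ler_normB _ _)) // mulr_natl mulr2n lerD.
  apply: (@le_trans _ _ (2 * B1 / d * `|x - a|)).
    rewrite -[leRHS]mulrA; apply: ler_peMr; first by rewrite mulr_ge0.
    by rewrite mulrC ler_pdivlMr // mul1r.
  by rewrite ler_wpM2r // lerDr addr_ge0.
have := dl (x - a); rewrite /ball_ /= sub0r normrN => /(_ near).
rewrite subr_eq0 => /(_ xa).
rewrite [_%:A]mulr1 subrK => H.
have E : g x - g a = ((x - a)^-1 *: (g x - g a)) * (x - a).
  by rewrite /GRing.scale /= mulrC mulVKf // subr_eq0.
rewrite {1}E normrM ler_wpM2r //.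
set q := _ *: _ in H *.
rewrite (le_trans (y := `|l| + 1)) //.
  have -> : q = l - (l - q) by ring.
  by rewrite (le_trans (ler_normB _ _)) // lerD2l.
by rewrite lerDl divr_ge0 ?mulr_ge0 // ltW.
Qed.

(** * Inner, cross and triple products in dimension three *)

Lemma dotpE {R : realType} (x y : 'cV[R]_3) :
  dotp x y = x 0 0 * y 0 0 + x 1 0 * y 1 0 + x 2%R 0 * y 2%R 0.
Proof.
rewrite /dotp mxE !big_ord_recl big_ord0 addr0 addrA !mxE.
have e1 : lift ord0 ord0 = 1 :> 'I_3 by apply: val_inj.
have e2 : lift ord0 (lift ord0 ord0) = 2 :> 'I_3 by apply: val_inj.
by rewrite e1 e2.
Qed.

Lemma colvec3P {R : realType} (x y : 'cV[R]_3) :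
  x 0 0 = y 0 0 -> x 1 0 = y 1 0 -> x 2%R 0 = y 2%R 0 -> x = y.
Proof.
move=> e0 e1 e2; apply/colP => -[[|[|[|//]]] lt_k].
- by rewrite (_ : Ordinal _ = 0) //; apply: val_inj.
- by rewrite (_ : Ordinal _ = 1) //; apply: val_inj.
- by rewrite (_ : Ordinal _ = 2) //; apply: val_inj.
Qed.

Lemma hatE {R : realType} (x y : 'cV[R]_3) :
  ((hat x *m y) 0 0 = x 1 0 * y 2%R 0 - x 2%R 0 * y 1 0) *
  ((hat x *m y) 1 0 = x 2%R 0 * y 0 0 - x 0 0 * y 2%R 0) *
  ((hat x *m y) 2%R 0 = x 0 0 * y 1 0 - x 1 0 * y 0 0).
Proof.
have e1 : lift ord0 ord0 = 1 :> 'I_3 by apply: val_inj.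
have e2 : lift ord0 (lift ord0 ord0) = 2 :> 'I_3 by apply: val_inj.
by do ![split]; rewrite !mxE !big_ord_recl big_ord0 !mxE /= ?e1 ?e2; ring.
Qed.

Lemma dotpC {R : realType} (x y : 'cV[R]_3) : dotp x y = dotp y x.
Proof. by rewrite !dotpE; ring. Qed.

Lemma dotpDl {R : realType} (x y z : 'cV[R]_3) :
  dotp (x + y) z = dotp x z + dotp y z.
Proof. by rewrite !dotpE !mxE; ring. Qed.

Lemma dotpZl {R : realType} (a : R) (x z : 'cV[R]_3) :
  dotp (a *: x) z = a * dotp x z.
Proof. by rewrite !dotpE !mxE; ring. Qed.

Lemma dotp0l {R : realType} (z : 'cV[R]_3) : dotp 0 z = 0.
Proof. by rewrite !dotpE !mxE; ring. Qed.

Lemma dotp_suml {R : realType} (I : finType) (P : pred I) (x : I -> 'cV[R]_3) z :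
  dotp (\sum_(i | P i) x i) z = \sum_(i | P i) dotp (x i) z.
Proof.
apply: (big_morph (fun x => dotp x z)) => [x1 x2|]; [exact: dotpDl|exact: dotp0l].
Qed.

Lemma dotp_ge0 {R : realType} (x : 'cV[R]_3) : 0 <= dotp x x.
Proof. by rewrite dotpE !addr_ge0 // -expr2 sqr_ge0. Qed.

Lemma dotp_eq0 {R : realType} (x : 'cV[R]_3) : dotp x x = 0 -> x = 0.
Proof.
rewrite dotpE => E.
have [s0 s1 s2] := And3 (sqr_ge0 (x 0 0)) (sqr_ge0 (x 1 0)) (sqr_ge0 (x 2%R 0)).
by apply: colvec3P; rewrite mxE; apply/eqP; rewrite -sqrf_eq0; apply/eqP; nra.
Qed.

Lemma sphere2E {R : realType} (x : 'cV[R]_3) : sphere2 x <-> dotp x x = 1.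
Proof.
rewrite /sphere2 /= /euclidean_norm; split=> [e|->]; last exact: sqrtr1.
by rewrite -(sqr_sqrtr (dotp_ge0 x)) e expr1n.
Qed.

Lemma hat_self {R : realType} (x : 'cV[R]_3) : hat x *m x = 0.
Proof. by apply: colvec3P; rewrite hatE mxE; ring. Qed.

Lemma hatZ {R : realType} (a : R) (x : 'cV[R]_3) : hat (a *: x) = a *: hat x.
Proof.
by apply/matrixP => -[[|[|[|//]]] ?] -[[|[|[|//]]] ?]; rewrite !mxE /=; ring.
Qed.

Lemma hat_hat {R : realType} (x y : 'cV[R]_3) :
  hat x *m (hat x *m y) = dotp x y *: x - dotp x x *: y.
Proof. by apply: colvec3P; rewrite !hatE !mxE !dotpE; ring. Qed.

(** Lagrange's identity. *)
Lemma dotp_hat_hat {R : realType} (x y : 'cV[R]_3) :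
  dotp (hat x *m y) (hat x *m y) = dotp x x * dotp y y - dotp x y ^+ 2.
Proof. by rewrite !dotpE !hatE; ring. Qed.

Definition triple {R : realType} (x y z : 'cV[R]_3) : R := dotp (hat x *m y) z.

(** The square of a determinant is the Gram determinant. *)
Lemma triple_sqr {R : realType} (x y z : 'cV[R]_3) :
  triple x y z ^+ 2 =
  dotp x x * dotp y y * dotp z z + 2 * dotp x y * dotp y z * dotp x z
  - dotp x x * dotp y z ^+ 2 - dotp y y * dotp x z ^+ 2
  - dotp z z * dotp x y ^+ 2.
Proof. by rewrite /triple !dotpE !hatE; ring. Qed.

(** * Geometry of a regular tetrahedron *)

(** The inner products of the base are listed along the cycle [y, z, w], so that
    rotating the base permutes the hypotheses of each field. *)
Record regular_tetrahedron {R : realType} (x y z w : 'cV[R]_3) : Prop := {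
  rt_norm : [/\ dotp x x = 1, dotp y y = 1, dotp z z = 1 & dotp w w = 1];
  rt_apex : [/\ dotp x y = - (1 / 3), dotp x z = - (1 / 3) & dotp x w = - (1 / 3)];
  rt_base : [/\ dotp y z = - (1 / 3), dotp z w = - (1 / 3) & dotp w y = - (1 / 3)]
}.

Lemma regular_tetrahedron_rot {R : realType} (x y z w : 'cV[R]_3) :
  regular_tetrahedron x y z w -> regular_tetrahedron x z w y.
Proof. by case=> -[? ? ? ?] [? ? ?] [? ? ?]; split; split. Qed.

Lemma tetrahedron_sum0 {R : realType} (x y z w : 'cV[R]_3) :
  regular_tetrahedron x y z w -> x + y + z + w = 0.
Proof.
case=> -[xx yy zz ww] [xy xz xw] [yz zw wy]; apply: dotp_eq0.
have -> : dotp (x + y + z + w) (x + y + z + w) =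
  dotp x x + dotp y y + dotp z z + dotp w w
  + 2 * (dotp x y + dotp x z + dotp x w + dotp y z + dotp z w + dotp w y).
  by rewrite !dotpE !mxE; ring.
by rewrite xx yy zz ww xy xz xw yz zw wy; field.
Qed.

Lemma tetrahedron_last {R : realType} (x y z w : 'cV[R]_3) :
  regular_tetrahedron x y z w -> w = - (x + y + z).
Proof. by move/tetrahedron_sum0/eqP; rewrite addrC addr_eq0 => /eqP. Qed.

Lemma tetrahedron_triple_sqr {R : realType} (x y z w : 'cV[R]_3) :
  regular_tetrahedron x y z w -> triple x y z ^+ 2 = 16 / 27.
Proof.
case=> -[xx yy zz ww] [xy xz xw] [yz zw wy].
by rewrite triple_sqr xx yy zz xy xz yz; field.
Qed.

(** With the apex [x] fixed, a cyclic permutation of the base preserves the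
    orientation: the three base vertices play the same role in what follows. *)
Lemma tetrahedron_triple_rot {R : realType} (x y z w : 'cV[R]_3) :
  regular_tetrahedron x y z w -> triple x z w = triple x y z.
Proof.
by move/tetrahedron_last => ->; rewrite /triple !dotpE !hatE !mxE; ring.
Qed.

(** Both sides have inner product 0 with [x] and [y], and the same one with [z].
    Rather than using that [x, y, z] is a basis, the squared norm of their
    difference is computed: it equals [8/9 - 3/2 D^2], which is zero. *)
Lemma tetrahedron_cross {R : realType} (x y z w : 'cV[R]_3) :
  regular_tetrahedron x y z w ->
  hat x *m y = (3 / 4 * triple x y z) *: (z - w).
Proof.
move=> rt; have D2 := tetrahedron_triple_sqr rt.
have c2 := dotp_hat_hat x y.
have tw : dotp (hat x *m y) w = - triple x y z.
  by rewrite (tetrahedron_last rt) /triple !dotpE !hatE !mxE; ring.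
case: rt => -[xx yy zz ww] [xy xz xw] [yz zw wy].
apply/eqP; rewrite -subr_eq0; apply/eqP; apply: dotp_eq0.
set v := hat x *m y in c2 tw *.
have tz : dotp v z = triple x y z by [].
move: (triple x y z) D2 tw tz => D D2 tw tz.
have -> : dotp (v - (3 / 4 * D) *: (z - w)) (v - (3 / 4 * D) *: (z - w)) =
  dotp v v - 3 / 2 * D * (dotp v z - dotp v w)
  + 9 / 16 * D ^+ 2 * (dotp z z + dotp w w - 2 * dotp z w).
  by rewrite !dotpE !mxE; field.
rewrite c2 tz tw xx yy xy zz ww zw.
transitivity (8 / 9 - 3 / 2 * D ^+ 2); first by field.
by rewrite D2; field.
Qed.

(** * The equations satisfied by the Gram matrix of a solution *)

Lemma agent_val (k : nat) : (k.-1 < 4)%N -> agent k = k.-1 :> nat.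
Proof. exact: inordK. Qed.

Lemma edge_weightE {R : realType} (i j : 'I_4) :
  edge_weight i j = (nth [::] [:: [::    0; 2^-1; 2^-1; 2^-1];
                                  [:: 2^-1;    0;    1;    0];
                                  [:: 2^-1;    0;    0;    1];
                                  [:: 2^-1;    1;    0;    0]] i)`_j :> R.
Proof.
rewrite /edge_weight !inE !xpair_eqE -!val_eqE /= !agent_val //.
by case: i => -[|[|[|[|//]]]] ?; case: j => -[|[|[|[|//]]]] ?.
Qed.

Definition tetrahedral_gram {R : realType} (i j : 'I_4) : R :=
  if i == j then 1 else - (1 / 3).

(** With [s i] the sum of the weights out of [i], the left-hand side for
    [i != k] is [4/9 (s i + s k - 3 (W i k + W k i))]; it vanishes because all
    [s i] equal [3/2] and opposite weights sum to 1, whatever the asymmetry of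
    the cycle 2, 3, 4. *)
Lemma edge_weight_balance (R : realType) (i k : 'I_4) (T := @tetrahedral_gram R) :
  \sum_(j | j != i) edge_weight i j * (T i j * T i k - T j k) +
  \sum_(j | j != k) edge_weight k j * (T k j * T k i - T j i) = 0.
Proof.
rewrite {}/T [X in X + _]big_mkcond [X in _ + X]big_mkcond /= !big_ord_recl !big_ord0.
case: i => -[|[|[|[|//]]]] ?; case: k => -[|[|[|[|//]]]] ?;
  rewrite !edge_weightE /tetrahedral_gram -!val_eqE /=; by field.
Qed.

Lemma closed_loop_fieldE {R : realType} W (f : R -> R) (G : configuration R) i :
  closed_loop_field W f G i =
  \sum_(j | j != i) (W i j * f (angle G i j)) *:
     (dotp (G i) (G j) *: G i - dotp (G i) (G i) *: G j).
Proof.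
by rewrite /closed_loop_field mulmx_sumr; apply: eq_bigr => j _;
   rewrite -scalemxAr hat_hat.
Qed.

Lemma dotp_unit_le1 {R : realType} (x y : 'cV[R]_3) :
  dotp x x = 1 -> dotp y y = 1 -> `|dotp x y| <= 1.
Proof.
move=> xx yy; have := dotp_ge0 (hat x *m y).
by rewrite dotp_hat_hat xx yy mulr1 subr_ge0 -real_normK ?num_real // expr_le1.
Qed.

Lemma tetrahedral_gram_le1 {R : realType} (i j : 'I_4) :
  `|tetrahedral_gram i j : R| <= 1.
Proof. by rewrite /tetrahedral_gram; case: ifP => _; rewrite ler_norml; lra. Qed.

Lemma edge_weight_norm_le1 {R : realType} (i j : 'I_4) :
  `|edge_weight i j : R| <= 1.
Proof.
by rewrite /edge_weight; do 3?[case: ifP => _]; rewrite ler_norml; lra.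
Qed.

(** The derivative of the inner product of agents [i] and [k] along the closed
    loop. *)
Definition gram_rate {R : realType} (f : R -> R) (G : configuration R) (i k : 'I_4) : R :=
  dotp (closed_loop_field edge_weight f G i) (G k) +
  dotp (closed_loop_field edge_weight f G k) (G i).

(** The coefficients of the two errors, 2 on [a - a0] and 3 on the inner
    products, come from [|c1 c2 - c3| <= 2] and from telescoping
    [c1 c2 - t1 t2] through [t1 c2]. *)
Lemma closed_loop_summand_le {R : realType} (w a a0 c1 c2 c3 t1 t2 t3 A N : R) :
  `|w| <= 1 -> `|c1| <= 1 -> `|c2| <= 1 -> `|c3| <= 1 -> `|t1| <= 1 ->
  `|a - a0| <= A ->
  `|c1 - t1| <= N -> `|c2 - t2| <= N -> `|c3 - t3| <= N ->
  `|w * a * (c1 * c2 - c3) - a0 * (w * (t1 * t2 - t3))| <= 2 * A + 3 * `|a0| * N.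
Proof.
move=> w1 c11 c21 c31 t11 aA e1 e2 e3.
have -> : w * a * (c1 * c2 - c3) - a0 * (w * (t1 * t2 - t3)) =
  w * ((a - a0) * (c1 * c2 - c3) +
       a0 * ((c1 - t1) * c2 + t1 * (c2 - t2) - (c3 - t3))) by ring.
rewrite normrM; apply: (le_trans (ler_piMl _ w1)) => //.
apply: (le_trans (ler_normD _ _)); rewrite !normrM; apply: lerD.
  rewrite mulrC ler_pM //; apply: (le_trans (ler_normB _ _)); rewrite normrM.
  by rewrite [2]/(1 + 1) lerD // mulr_ile1.
rewrite -mulrA mulrCA ler_wpM2l //.
have p1 : `|(c1 - t1) * c2| <= N by rewrite normrM (le_trans (ler_piMr _ c21)).
have p2 : `|t1 * (c2 - t2)| <= N by rewrite normrM (le_trans (ler_piMl _ t11)).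
by move: p1 p2 e3; rewrite !ler_norml; lra.
Qed.

Section GramEstimate.
Variables (R : realType) (f : R -> R) (G : configuration R) (L N : R).
Let f0 := f (acos (- (1 / 3))).
Let T := @tetrahedral_gram R.
Hypothesis f_lip : forall x, `|f (acos x) - f0| <= L * `|x - - (1 / 3)|.
Hypothesis L_ge0 : 0 <= L.
Hypothesis G_unit : forall i, dotp (G i) (G i) = 1.
Hypothesis G_near : forall i j, `|dotp (G i) (G j) - T i j| <= N.

(** The two halves of [gram_rate] do not vanish separately on tetrahedra: each is
    compared with its tetrahedral value, and these cancel in [gram_rate_le]. *)
Lemma half_gram_rate_le i k :
  `|dotp (closed_loop_field edge_weight f G i) (G k) -
    f0 * \sum_(j | j != i) edge_weight i j * (T i j * T i k - T j k)|
  <= 4 * ((2 * L + 3 * `|f0|) * N).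
Proof.
have N0 : 0 <= N := le_trans (normr_ge0 _) (G_near i i).
have B0 : 0 <= (2 * L + 3 * `|f0|) * N by rewrite mulr_ge0 // addr_ge0 // mulr_ge0.
have -> : 4 * ((2 * L + 3 * `|f0|) * N) =
    \sum_(j < 4) (2 * L + 3 * `|f0|) * N.
  by rewrite sumr_const card_ord mulr_natl.
rewrite closed_loop_fieldE dotp_suml mulr_sumr -sumrB.
(* The bound sums over all four agents, the rate only over those other than [i]. *)
rewrite [leRHS](bigID (fun j => j != i)) /=.
apply: ler_wpDr; first by apply: sumr_ge0 => j _.
apply: (le_trans (ler_norm_sum _ _ _)); apply: ler_sum => j ji.
rewrite dotpZl [dotp (_ - _) _](_ : _ =
    dotp (G i) (G j) * dotp (G i) (G k) - dotp (G j) (G k)); last first.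
  by rewrite G_unit scale1r -scaleN1r dotpDl !dotpZl mulN1r.
rewrite mulrDl -(mulrA 2).
apply: closed_loop_summand_le; rewrite ?dotp_unit_le1 ?edge_weight_norm_le1
  ?tetrahedral_gram_le1 ?G_near //.
apply: (le_trans (f_lip _)); rewrite ler_wpM2l //.
by have := G_near i j; rewrite /T /tetrahedral_gram eq_sym (negbTE ji).
Qed.

Lemma gram_rate_le i k : `|gram_rate f G i k| <= 8 * (2 * L + 3 * `|f0|) * N.
Proof.
have := congr1 ( *%R f0) (edge_weight_balance R i k).
rewrite mulrDr mulr0 => bal.
move: (half_gram_rate_le i k) (half_gram_rate_le k i).
rewrite /gram_rate !ler_norml; move: bal; rewrite /T; lra.
Qed.

End GramEstimate.

(** The Lyapunov-type function whose zeros are the tetrahedra. *)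
Definition gram_defect {R : realType} (G : configuration R) : R :=
  \sum_i \sum_j (dotp (G i) (G j) - tetrahedral_gram i j) ^+ 2.

Definition gram_defect_rate {R : realType} (f : R -> R) (G : configuration R) : R :=
  \sum_i \sum_j 2 * (dotp (G i) (G j) - tetrahedral_gram i j) * gram_rate f G i j.

Lemma gram_defect_ge {R : realType} (G : configuration R) i j :
  (dotp (G i) (G j) - tetrahedral_gram i j) ^+ 2 <= gram_defect G.
Proof.
rewrite /gram_defect (bigD1 i) //= (bigD1 j) //= -addrA.
by rewrite lerDl addr_ge0 // ?sumr_ge0 // => k _; rewrite ?sumr_ge0 // => *; rewrite sqr_ge0.
Qed.

Lemma gram_defect_le0P {R : realType} (G : configuration R) :
  gram_defect G <= 0 <-> tetrahedra G.
Proof.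
split=> [d0|[Gs Ge]].
  have eT i j : dotp (G i) (G j) = tetrahedral_gram i j.
    apply/eqP; rewrite -subr_eq0 -sqrf_eq0 eq_le sqr_ge0 andbT.
    exact: le_trans (gram_defect_ge G i j) d0.
  split=> [i|i j ij]; first by apply/sphere2E; rewrite eT /tetrahedral_gram eqxx.
  by rewrite eT /tetrahedral_gram (negbTE ij).
rewrite /gram_defect big1 // => i _; rewrite big1 // => j _.
rewrite /tetrahedral_gram; have [<-|ij] := eqVneq i j.
  by rewrite (sphere2E _).1 // subrr expr0n.
by rewrite Ge // subrr expr0n.
Qed.

(** Every deviation is at most [N = sqrt V], so each of the 16 terms of the rate
    is at most [2 N] times the bound of [gram_rate_le], which is linear in [N]:
    the rate is [O(N^2) = O(V)]. *)
Lemma gram_defect_rate_le {R : realType} (f : R -> R) (L : R) (G : configuration R)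
    (f0 := f (acos (- (1 / 3)))) :
  (forall x, `|f (acos x) - f0| <= L * `|x - - (1 / 3)|) -> 0 <= L ->
  (forall i, dotp (G i) (G i) = 1) ->
  gram_defect_rate f G <= 256 * (2 * L + 3 * `|f0|) * gram_defect G.
Proof.
move=> f_lip L0 G_unit.
have V0 : 0 <= gram_defect G.
  by apply: sumr_ge0 => i _; apply: sumr_ge0 => j _; rewrite sqr_ge0.
have nearN i j : `|dotp (G i) (G j) - tetrahedral_gram i j| <= Num.sqrt (gram_defect G).
  by rewrite -sqrtr_sqr ler_wsqrtr // gram_defect_ge.
have := sqr_sqrtr V0; set N := Num.sqrt _ in nearN * => <-.
have N0 : 0 <= N by exact: sqrtr_ge0.
have -> : 256 * (2 * L + 3 * `|f0|) * N ^+ 2 =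
    \sum_(i < 4) \sum_(j < 4) 2 * N * (8 * (2 * L + 3 * `|f0|) * N).
  rewrite !sumr_const card_ord -mulrnA -mulr_natl; ring.
rewrite /gram_defect_rate; apply: ler_sum => i _; apply: ler_sum => j _.
rewrite (le_trans (ler_norm _)) // !normrM ler_pM // ?mulr_ge0 //.
  by rewrite ger0_norm // ler_wpM2l.
exact: gram_rate_le f_lip L0 G_unit nearN i j.
Qed.

Lemma gram_has_rate {R : realType} (f : R -> R) (G : R -> configuration R) i j :
  closed_loop_solution edge_weight f G ->
  has_rate (fun t => dotp (G t i) (G t j)) (fun t => gram_rate f (G t) i j).
Proof.
case=> _ Gc Gd.
have re i' k := @has_rate_entry R 3 1 _ _ k 0 (Gc i') (fun t => Gd t i').
apply: (has_rate_eq (has_rateD (has_rateD (has_rateM (re i 0) (re j 0))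
  (has_rateM (re i 1) (re j 1))) (has_rateM (re i 2%R) (re j 2%R)))) => t /=.
  by rewrite dotpE.
by rewrite /gram_rate !dotpE; ring.
Qed.

Lemma tetrahedra_invariant {R : realType} (f : R -> R) (G : R -> configuration R) :
  bounded_fun f -> derivable f (acos (- (1 / 3))) 1 ->
  closed_loop_solution edge_weight f G -> tetrahedra (G 0) ->
  forall t, 0 <= t -> tetrahedra (G t).
Proof.
move=> fb fd Gsol G0 t t0.
have [L L0 lip] : exists2 L, 0 <= L & forall x : R,
    `|f (acos x) - f (acos (- (1 / 3)))| <= L * `|x - - (1 / 3)|.
  apply: (@bounded_derivable_lipschitz_at R (fun x => f (acos x))).
    by move: fb => [B [Br fB]]; exists B; split=> // y By x _; exact: fB.
  have da : is_derive (- (1 / 3) : R) 1 (@acos R) (- (Num.sqrt (1 - (- (1 / 3)) ^+ 2))^-1).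
    by apply: is_derive1_acos; lra.
  exact: (@ex_derive _ _ _ _ _ _ _ (is_derive1_comp (derivableP fd) da)).
apply/gram_defect_le0P; move: t t0.
have rV : has_rate (fun t => gram_defect (G t)) (fun t => gram_defect_rate f (G t)).
  apply: has_rate_sum => i; apply: has_rate_sum => j.
  have re := has_rateD (gram_has_rate i j Gsol) (has_rate_cst (- tetrahedral_gram i j)).
  by apply: (has_rate_eq (has_rateM re re)) => t /=; ring.
apply: (gronwall_nonpos rV).
  move=> t t0; apply: (gram_defect_rate_le lip L0) => i.
  by apply/sphere2E; case: Gsol => /(_ t i (ltW t0)).
exact/gram_defect_le0P.
Qed.

(** * The motion on the tetrahedra *)

Lemma agent_cases (P : 'I_4 -> Prop) :
  P (agent 1) -> P (agent 2) -> P (agent 3) -> P (agent 4) -> forall i, P i.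
Proof.
move=> P1 P2 P3 P4 i.
have eP k (lt_k : (k.-1 < 4)%N) : val i = k.-1 -> P (agent k) -> P i.
  by move=> ik; rewrite (_ : i = agent k) //; apply: val_inj; rewrite ik /= agent_val.
case: i eP => -[|[|[|[|//]]]] lt_i eP.
- exact: (eP 1%N).
- exact: (eP 2%N).
- exact: (eP 3%N).
- exact: (eP 4%N).
Qed.

Lemma sum_agents {V : zmodType} (F : 'I_4 -> V) :
  \sum_i F i = F (agent 1) + F (agent 2) + F (agent 3) + F (agent 4).
Proof.
rewrite !big_ord_recl big_ord0 addr0 !addrA.
by congr (F _ + F _ + F _ + F _); apply: val_inj; rewrite /= agent_val.
Qed.

Lemma regular_tetrahedron_agents {R : realType} (G : configuration R) :
  tetrahedra G ->
  regular_tetrahedron (G (agent 1)) (G (agent 2)) (G (agent 3)) (G (agent 4)).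
Proof.
move=> [Gs Ge].
have Gu i : dotp (G i) (G i) = 1 by apply/sphere2E.
by split; split; rewrite ?Gu // Ge // -val_eqE /= !agent_val.
Qed.

(** For agent 2, say, the field is
    [f(theta) (- G_2 / 2 - G_1 / 2 - G_3)], and the vanishing sum of the
    vertices turns it into half an edge. *)
Lemma tetrahedral_field {R : realType} (f : R -> R) (G : configuration R)
    (a := f (acos (- (1 / 3))) / 2) :
  tetrahedra G ->
  [/\ closed_loop_field edge_weight f G (agent 1) = 0,
      closed_loop_field edge_weight f G (agent 2) = a *: (G (agent 4) - G (agent 3)),
      closed_loop_field edge_weight f G (agent 3) = a *: (G (agent 2) - G (agent 4))
    & closed_loop_field edge_weight f G (agent 4) = a *: (G (agent 3) - G (agent 2))].
Proof.
move=> Gt; have [Gs Ge] := Gt.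
have FE i : closed_loop_field edge_weight f G i =
    \sum_j (edge_weight i j * (2 * a)) *: (- (1 / 3) *: G i - G j).
  rewrite closed_loop_fieldE [RHS](bigD1 i) //= [edge_weight i i]/edge_weight eqxx.
  rewrite mul0r scale0r add0r; apply: eq_bigr => j ji.
  rewrite /angle Ge 1?eq_sym // (sphere2E _).1 // scale1r.
  by congr ((_ * _) *: _); rewrite /a; field.
have := tetrahedron_last (regular_tetrahedron_agents Gt).
rewrite !FE !sum_agents !edge_weightE !agent_val //= => ->.
by split; apply/matrixP => k l; rewrite !mxE; field.
Qed.

Lemma triple_continuous {R : realType} (x y z : R -> 'cV[R]_3) (A : set R) :
  {within A, continuous x} -> {within A, continuous y} ->
  {within A, continuous z} ->
  {within A, continuous (fun t => triple (x t) (y t) (z t))}.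
Proof.
move=> cx cy cz.
have ce (v : R -> 'cV[R]_3) k : {within A, continuous v} ->
    {within A, continuous (fun t => v t k 0)}.
  by move=> cv t; exact: cvg_comp (cv t) (@coord_continuous _ _ _ k 0 (v t)).
have -> : (fun t => triple (x t) (y t) (z t)) = fun t =>
   (x t 1 0 * y t 2%R 0 - x t 2%R 0 * y t 1 0) * z t 0 0 +
   (x t 2%R 0 * y t 0 0 - x t 0 0 * y t 2%R 0) * z t 1 0 +
   (x t 0 0 * y t 1 0 - x t 1 0 * y t 0 0) * z t 2%R 0.
  by apply/funext => t; rewrite /triple dotpE !hatE.
have cD (u v : R -> R) : {within A, continuous u} -> {within A, continuous v} ->
    {within A, continuous (fun t => u t + v t)}.
  by move=> cu cv t; apply: continuousD; [exact: cu | exact: cv].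
have cB (u v : R -> R) : {within A, continuous u} -> {within A, continuous v} ->
    {within A, continuous (fun t => u t - v t)}.
  by move=> cu cv t; apply: continuousB; [exact: cu | exact: cv].
have cM (u v : R -> R) : {within A, continuous u} -> {within A, continuous v} ->
    {within A, continuous (fun t => u t * v t)}.
  by move=> cu cv t; apply: continuousM; [exact: cu | exact: cv].
by apply: (cD); [apply: (cD)|]; apply: (cM) (ce _ _ cz); apply: (cB);
   apply: (cM); exact: ce.
Qed.

(** A change of sign would force a zero, by the intermediate value theorem. *)
Lemma constant_of_constant_sqr {R : realType} (h : R -> R) (d : R) :
  {within `[0, +oo[, continuous h} -> d != 0 ->
  (forall t, 0 <= t -> h t ^+ 2 = d) -> forall t, 0 <= t -> h t = h 0.
Proof.
move=> ch d0 hd t t0.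
have /eqP : h t ^+ 2 = h 0 ^+ 2 by rewrite !hd.
rewrite eqf_sqr => /predU1P[//|/eqP ht].
have [||c /itvP ct hc] := @IVT R h 0 t 0 t0.
- by apply: continuous_subspaceW ch; apply: subset_itvl; rewrite bnd_simp.
- by rewrite ht; case: (lerP (h 0) (- h 0)) => ?; apply/andP; split; lra.
by move: d0; rewrite -(hd c) ?ct // hc expr0n eqxx.
Qed.

Theorem proposition5p3 (R : realType) (f : R -> R)
    (f_bounded : bounded_fun f)
    (f_pos : forall x, x \in `]0, pi[ -> 0 < f x)
    (f_deriv : forall x, x \in `]0, pi[ -> derivable f x 1 /\ derive1 f x < 0)
    (G : R -> configuration R)
    (G_sol : closed_loop_solution edge_weight f G)
    (G_init : tetrahedra (G 0)) :
  let theta := acos (- (1 / 3)) in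
  let omega := Num.sqrt 3 / 2 * f theta in
  (forall t, 0 <= t -> tetrahedra (G t)) /\
  (forall t, 0 <= t -> G t (agent 1) = G 0 (agent 1)) /\
  exists Om : 'cV[R]_3,
    [/\ exists c : R, Om = c *: G 0 (agent 1),
        euclidean_norm Om = omega
      & spins_with_angular_velocity G Om].
Proof.
move=> theta omega.
have theta_itv : theta \in `]0, pi[.
  by rewrite in_itv /= acos_gt0 ?acos_ltpi //; lra.
have [[f_der _] f_gt0] := (f_deriv _ theta_itv, f_pos _ theta_itv).
have G_tet := tetrahedra_invariant f_bounded f_der G_sol G_init.
have [_ G_cont G_der] := G_sol.
have G_reg t t0 := regular_tetrahedron_agents (G_tet t t0).
have G1 t : 0 <= t -> G t (agent 1) = G 0 (agent 1).
  move=> t0; apply/matrixP => k l.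
  apply: (has_rate0_cst (has_rate_entry k l (G_cont (agent 1))
    (fun t => G_der t (agent 1)))) t0 => s s0.
  by have [-> _ _ _] := tetrahedral_field f (G_tet s (ltW s0)); rewrite mxE.
pose D t := triple (G t (agent 1)) (G t (agent 2)) (G t (agent 3)).
have D2 t (t0 : 0 <= t) : D t ^+ 2 = 16 / 27 := tetrahedron_triple_sqr (G_reg t t0).
have D_cst t : 0 <= t -> D t = D 0.
  move: t; apply: (@constant_of_constant_sqr R D (16 / 27)) => //.
  exact: triple_continuous.
(* [c (3/4 D) = - f theta / 2] matches [tetrahedron_cross] with
   [tetrahedral_field]; since [D^2 = 16/27], its solution is [- 9/8 f theta D]. *)
pose c := - (9 / 8) * f theta * D 0.
split=> //; split=> //; exists (c *: G 0 (agent 1)); split; first by exists c.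
  rewrite /euclidean_norm dotpZl dotpC dotpZl (sphere2E _).1; last by case: G_init.
  (* The sign of [c] depends on the orientation; only its square matters here. *)
  have -> : c * (c * 1) = omega ^+ 2.
    rewrite /omega !exprMn sqr_sqrtr //.
    transitivity (81 / 64 * f theta ^+ 2 * D 0 ^+ 2); first by rewrite /c; field.
    by rewrite D2 //; field.
  by rewrite sqrtr_sqr ger0_norm // !mulr_ge0 ?sqrtr_ge0 // ltW.
move=> t i t0; have := G_der t i t0; have t0' := ltW t0.
rewrite hatZ -scalemxAl -(G1 t t0').
have rt2 := G_reg t t0'; have rt3 := regular_tetrahedron_rot rt2.
have rt4 := regular_tetrahedron_rot rt3.
have cD : c * (3 / 4 * D t) = - (f theta / 2).
  transitivity (- (27 / 32) * f theta * D t ^+ 2); last by rewrite D2 //; field.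
  by rewrite /c -(D_cst t t0'); field.
have [F1 F2 F3 F4] := tetrahedral_field f (G_tet t t0').
move: i; apply: agent_cases.
- by rewrite F1 hat_self scaler0.
- by rewrite F2 (tetrahedron_cross rt2) scalerA cD scaleNr -scalerN opprB.
- rewrite F3 (tetrahedron_cross rt3) (tetrahedron_triple_rot rt2).
  by rewrite scalerA cD scaleNr -scalerN opprB.
- rewrite F4 (tetrahedron_cross rt4) (tetrahedron_triple_rot rt3).
  by rewrite (tetrahedron_triple_rot rt2) scalerA cD scaleNr -scalerN opprB.
Qed.
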